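(* Let $q=4k$, where $k=2^{\ell}$ for some integer $\ell\ge 2$, and let $G=\langle a,b\rangle\le\mathfrak{S}_q$ be the group described in the context. Let $f_3$ be a permutation group polynomial over $\mathbb{F}_q$ corresponding to $G$, and let $\mathcal{P}_{f_3}$ be the number of permutation group polynomials over $\mathbb{F}_q$ of the same form as $f_3$. Then $$\mathcal{P}_{f_3}=\dfrac{4(q!)^2}{q^2\,\phi(\frac{q}{2})}.$$
   Context: $\phi$ is Euler's totient function. $\mathfrak{S}_q$ is the symmetric group on $\mathbb{F}_q=\{c_0,\ldots,c_{q-1}\}$ (a fixed enumeration); permutations are composed right to left. The permutations are $a=(c_0,c_1)(c_2,c_3)\cdots(c_{q-2},c_{q-1})$ and $$\begin{aligned}b=&(c_0,c_{2k+1},\ldots,c_{2n_1},c_{2n_1+2k+1},\ldots,c_{k-2},c_{3k-1},\;c_{k+1},c_{3k},\;c_{k+2},c_{3k+2},\ldots,c_{2(n_2+1)+k},c_{2(n_2+1)+3k},\ldots,c_{2k-2},c_{4k-2})\\&(c_{3k-2},c_{2k-1},\ldots,c_{3k-2-2n_2},c_{2k-1-2n_2},\ldots,c_{2k+2},c_{k+3},\;c_{2k},c_{k},\;c_{4k-1},c_{k-1},\ldots,c_{4k-1-2n_1},c_{k-1-2n_1},\ldots,c_{3k+1},c_{1}),\end{aligned}$$ where in each of the two cycles (of length $2k$) $n_1$ runs over $0,1,\ldots,\frac{k-2}{2}$ and $n_2$ runs over $0,1,\ldots,\frac{k-4}{2}$. It is known that $|a|=2$, $|b|=2k$, $ab=b^{k-1}a$,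 that $G=\langle a,b\rangle=\{b^ja^i: 0\le j\le \frac q2-1,\ 0\le i\le 1\}$ has order $q$, and that no non-identity element of $G$ has a fixed point. Functions $\mathbb{F}_q^2\to\mathbb{F}_q$ are identified with polynomials in $\mathbb{F}_q[X_1,X_2]$ of degree less than $q$ in each variable (these are the polynomials being counted). A bivariate polynomial $f$ is a local permutation polynomial (LPP) if for every $c\in\mathbb{F}_q$ both $x\mapsto f(x,c)$ and $x\mapsto f(c,x)$ are bijections of $\mathbb{F}_q$. Bivariate LPPs are in bijection with permutation polynomial tuples, i.e. tuples $\underline{\beta}_f=(\beta_0,\ldots,\beta_{q-1})\in\mathfrak{S}_q^q$ such that $\beta_i\beta_j^{-1}$ has no fixed point for $i\ne j$, via $f(x,\beta_i(x))=c_i$ for all $x\in\mathbb{F}_q$ and all $i$. An LPP is a permutation group polynomial if the entries of its tuple form a subgroup of $\mathfrak{S}_q$, and it then corresponds to that subgroup. Two permutation group polynomials over $\mathbb{F}_q$ are of the same form if their corresponding subgroups of $\mathfrak{S}_q$ are isomorphic as groups. *)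

(* Defs.v *)
From HB Require Import structures.
From mathcomp Require Import all_boot all_fingroup all_algebra.
From mathcomp Require Import finmap mpoly.
From mathcomp Require Import boolp classical_sets cardinality.

Set Implicit Arguments.
Unset Strict Implicit.
Unset Printing Implicit Defensive.

Import GRing.Theory.
Local Open Scope ring_scope.

(* The cyclic permutation x_0 |-> x_1 |-> ... |-> x_n |-> x_0 for
   s = [:: x_0; ...; x_n]. The removal of duplicates only serves to make this
   total: undup s = s for the duplicate-free sequences used below. *)
Definition cycle_perm (T : finType) (s : seq T) : {perm T} :=
  perm (can_inj (prev_next (undup_uniq s))).

(* MathComp composes permutations left to right, (s * t) x = t (s x). *)
Section Generators.
Variables (F : finFieldType) (k : nat) (c : seq F).

Definition a_cycle (i : nat) : seq F := [:: c`_(2 * i); c`_(2 * i + 1)].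

Definition perm_a : {perm F} := (\prod_(i < 2 * k) cycle_perm (a_cycle i))%g.

Definition n1_range := iota 0 ((k - 2) %/ 2).+1.
Definition n2_range := iota 0 ((k - 4) %/ 2).+1.

Definition b_cycle1 : seq F :=
  flatten [seq [:: c`_(2 * n1); c`_(2 * n1 + 2 * k + 1)] | n1 <- n1_range]
  ++ [:: c`_(k + 1); c`_(3 * k)]
  ++ flatten [seq [:: c`_(2 * (n2 + 1) + k); c`_(2 * (n2 + 1) + 3 * k)]
             | n2 <- n2_range].

Definition b_cycle2 : seq F :=
  flatten [seq [:: c`_(3 * k - 2 - 2 * n2); c`_(2 * k - 1 - 2 * n2)]
          | n2 <- n2_range]
  ++ [:: c`_(2 * k); c`_k]
  ++ flatten [seq [:: c`_(4 * k - 1 - 2 * n1); c`_(k - 1 - 2 * n1)]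
             | n1 <- n1_range].

Definition perm_b : {perm F} := (cycle_perm b_cycle1 * cycle_perm b_cycle2)%g.

Definition group_ab : {group {perm F}} := <<[set perm_a; perm_b]>>%G.

End Generators.

Section LocalPermutationPolynomials.
Variables (F : finFieldType) (q : nat) (c : q.-tuple F).

Definition eval2 (f : {mpoly F[2]}) (x y : F) : F :=
  f.@[tnth [tuple x; y]].

Definition reduced (f : {mpoly F[2]}) : Prop :=
  forall m : 'X_{1..2}, m \in msupp f -> forall i : 'I_2, (m i < #|F|)%N.

Definition lpp (f : {mpoly F[2]}) : Prop :=
  forall z : F, bijective (fun x => eval2 f x z) /\
                bijective (fun x => eval2 f z x).

(* (beta_j^-1 * beta_i) x = beta_i (beta_j^-1 x) is the right-to-left composite
   beta_i beta_j^-1 applied to x. *)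
Definition perm_poly_tuple (beta : q.-tuple {perm F}) : Prop :=
  forall i j : 'I_q, i != j ->
  forall x : F, ((tnth beta j)^-1 * tnth beta i)%g x != x.

Definition tuple_of_lpp (f : {mpoly F[2]}) (beta : q.-tuple {perm F}) : Prop :=
  perm_poly_tuple beta /\
  forall (i : 'I_q) (x : F), eval2 f x (tnth beta i x) = tnth c i.

Definition corresponds_to (f : {mpoly F[2]}) (H : {group {perm F}}) : Prop :=
  [/\ reduced f, lpp f &
      exists2 beta : q.-tuple {perm F},
        tuple_of_lpp f beta & [set s in beta] = H].

Definition perm_group_poly (f : {mpoly F[2]}) : Prop :=
  exists H : {group {perm F}}, corresponds_to f H.

Definition same_form (f g : {mpoly F[2]}) : Prop :=
  exists H K : {group {perm F}},
    [/\ corresponds_to f H, corresponds_to g K & H \isog K].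

(* fset_set returns the empty set on infinite sets; here [reduced] bounds the
   degrees, so the set is finite. *)
Definition num_same_form (f : {mpoly F[2]}) : nat :=
  #|` fset_set [set g | perm_group_poly g /\ same_form f g]%classic |.

End LocalPermutationPolynomials.

(* Main.v *)
(* A polynomial f of the required kind amounts to a permutation group K with K
   isomorphic to G, together with an ordering of K; the fixed-point condition on
   tuples says that K acts regularly on F. Two isomorphic regular groups are
   conjugate in Sym(F), and the normalizer of G has order q |Aut G|, an element
   of it being determined by its action on G and the image of one point. Hence
   there are q! / (q |Aut G|) such K, each with q! orderings. The relations
   b^(2k) = a^2 = 1 and a b a = b^(k-1) make G semidihedral: its automorphisms
   send b to any generator of <b> and a to any involution b^(2i) a outside <b>,
   so |Aut G| = k phi(2k). *)
Require Import Defs.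
From HB Require Import structures.
From mathcomp Require Import all_boot all_fingroup all_algebra.
From mathcomp Require Import finmap mpoly.
From mathcomp Require Import all_solvable zify ring.

Set Implicit Arguments.
Unset Strict Implicit.
Unset Printing Implicit Defensive.

Import GRing.Theory.

(** * Regular permutation groups: conjugacy and normalizers *)

Section RegularGroups.
Variable T : finType.
Local Open Scope group_scope.
Implicit Types (H K : {group {perm T}}) (x y : T).

Definition fixpoint_free (A : {set {perm T}}) : Prop :=
  forall s, s \in A -> s != 1 -> forall x, s x != x.

Definition regular_perm (A : {set {perm T}}) : Prop :=
  fixpoint_free A /\ #|A| = #|T|.

Lemma fixpoint_free_inj H s t x :
  fixpoint_free H -> s \in H -> t \in H -> s x = t x -> s = t.
Proof.
move=> ffH Hs Ht st; apply/eqP; rewrite eq_mulVg1; apply/idPn => /ffH.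
move/(_ (groupM (groupVr Hs) Ht) (s x))/eqP; apply.
by rewrite permM permK st.
Qed.

(** Freeness makes evaluation at [x] injective on [H], and [#|H| = #|T|] then makes it
    surjective. *)
Lemma regular_permP H x y :
  regular_perm H -> exists2 s, s \in H & s x = y.
Proof.
move=> [ffH cardH].
have inj : {in H &, injective (fun s : {perm T} => s x)}.
  by move=> s t Hs Ht; apply: fixpoint_free_inj ffH Hs Ht.
have /setP/(_ y) : [set (s : {perm T}) x | s in H] = setT.
  by apply/eqP; rewrite eqEcard subsetT card_in_imset // cardH cardsT leqnn.
by rewrite inE => /imsetP[s Hs ->]; exists s.
Qed.

(* The conjugator can only be [h x |-> (f h) y]. *)
Lemma regular_isom_conj H K (f : {morphism H >-> {perm T}}) x y :
    regular_perm H -> regular_perm K -> f @* H = K ->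
  exists2 s : {perm T}, s x = y & {in H, forall h, h ^ s = f h}.
Proof.
move=> regH regK fHK.
(* [h z] is the unique element of [H] taking [x] to [z]; by transitivity the default [1] never
   occurs. *)
pose h z := odflt 1 [pick g in H | (g : {perm T}) x == z].
have hP z : h z \in H /\ h z x = z.
  rewrite /h; case: pickP => [g /andP[Hg /eqP] // | none].
  have [g Hg gx] := regular_permP x z regH.
  by have := none g; rewrite Hg gx eqxx.
have hE g : g \in H -> h (g x) = g.
  move=> Hg; have [Hh hx] := hP (g x).
  exact: fixpoint_free_inj regH.1 Hh Hg hx.
have injf : 'injm f.
  by rewrite -card_im_injm fHK regH.2 regK.2.
have injs : injective (fun z => f (h z) y).
  move=> z z' /= fz; have [Hz hz] := hP z; have [Hz' hz'] := hP z'.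
  have fK z0 : h z0 \in H -> f (h z0) \in K by move=> ?; rewrite -fHK mem_morphim.
  have /(injmP injf) := fixpoint_free_inj regK.1 (fK _ Hz) (fK _ Hz') fz.
  by move=> /(_ Hz Hz') hzz'; rewrite -hz hzz' hz'.
exists (perm injs).
  by have := hE 1 (group1 _); rewrite permE perm1 => ->; rewrite morph1 perm1.
move=> g Hg; apply/permP => z.
have -> : z = perm injs ((perm injs)^-1 z) by rewrite permKV.
move: ((perm injs)^-1%g z) => {}z; rewrite permJ !permE.
have [Hz hz] := hP z.
by rewrite -{1}hz -permM hE ?groupM // morphM // permM.
Qed.

Lemma regular_isog_conj H K :
    regular_perm H -> fixpoint_free K -> H \isog K -> (0 < #|T|)%N ->
  (K : {set _}) \in H :^: setT.
Proof.
move=> regH ffK isoHK /card_gt0P[x _]; have [f injf fHK] := isogP isoHK.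
have regK : regular_perm K by split=> //; rewrite -(card_isog isoHK) regH.2.
have [s _ sf] := regular_isom_conj x x regH regK fHK.
apply/imsetP; exists s; rewrite ?inE // -fHK.
rewrite morphimEdom /conjugate; apply/eq_in_imset => h Hh /=.
by rewrite sf.
Qed.

(** Sending [s] to its conjugation automorphism and the image of a base point is a bijection from
    ['N(H)] onto [Aut H] times [T]; [regular_isom_conj], applied to automorphisms of [H], gives
    surjectivity. *)
Lemma card_norm_regular H :
  regular_perm H -> (0 < #|T|)%N -> #|'N(H)| = (#|Aut H| * #|T|)%N.
Proof.
move=> regH /card_gt0P[x0 _].
pose phi (s : {perm T}) := (conj_aut H s, s x0).
have injphi : {in 'N(H) &, injective phi}.
  move=> s t Ns Nt [cst st].
  have Nu : s * t^-1 \in 'N(H) by rewrite groupM ?groupV.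
  have ux : (s * t^-1) x0 = x0 by rewrite permM st permK.
  have uC h : h \in H -> h ^ (s * t^-1) = h.
    move=> Hh; rewrite conjgM -(norm_conj_autE Ns Hh) cst (norm_conj_autE Nt Hh).
    by rewrite -conjgM mulgV conjg1.
  apply/eqP; rewrite eq_mulgV1; apply/eqP/permP => z.
  (* A permutation that centralizes [H] and fixes [x0] fixes every [h x0], hence every point. *)
  have [h Hh <-] := regular_permP x0 z regH.
  by rewrite perm1 -permJ uC // ux.
have Aconj s : s \in 'N(H) -> conj_aut H s \in Aut H.
  by move=> Ns; apply: (subsetP (Aut_conj_aut H 'N(H))); apply: mem_morphim.
rewrite -(card_in_imset injphi) -[#|T|]cardsT -cardsX.
apply: eq_card => -[u x]; rewrite in_setX in_setT andbT /=.
apply/imsetP/idP => [[s Ns [-> _]] | Au]; first exact: Aconj.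
have [s sx su] := regular_isom_conj x0 x regH regH (im_autm Au).
have Ns : s \in 'N(H).
  apply/normP; apply/eqP; rewrite eqEcard cardJg leqnn andbT.
  apply/subsetP=> _ /imsetP[h Hh ->]; rewrite su //.
  by have := mem_morphim (autm Au) Hh Hh; rewrite im_autm.
exists s => //; rewrite /phi sx; congr (_, _).
apply: (eq_Aut Au (Aconj s Ns)) => h Hh.
by rewrite norm_conj_autE // su.
Qed.

Lemma card_regular_conjugates H :
    regular_perm H -> (0 < #|T|)%N ->
  (#|H :^: [set: {perm T}]| * (#|Aut H| * #|T|) = (#|T|)`!)%N.
Proof.
move=> regH T0; rewrite -(card_norm_regular regH) // card_conjugates.
rewrite setTI mulnC (Lagrange (subsetT _)).
have := card_perm [set: T]; rewrite cardsT => <-.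
by apply: eq_card => s; rewrite !inE; apply/esym/subsetP => z; rewrite inE.
Qed.

End RegularGroups.

(** * Automorphisms of the semidihedral group *)

Section SemidihedralAut.
Variables (gT : finGroupType) (G : {group gT}) (a b : gT) (k : nat).
Local Open Scope group_scope.
Hypotheses (k_gt2 : (2 < k)%N) (ob : #[b] = (2 * k)%N) (aa : a ^+ 2 = 1)
  (notBa : a \notin <[b]>) (ba : b ^ a = b ^+ k.-1)
  (genG : G :=: <<[set a; b]>>).

Lemma sd_aV : a^-1 = a.
Proof. by apply/eqP; rewrite eq_invg_mul -expg2 aa. Qed.

(** As [<[b]>] is abelian, every element of the coset [<[b]> a] acts on it as [a] does; hence any
    such involution can replace [a] in the relations. *)
Lemma sd_conj x y : x \in <[b]> -> y \in <[b]> -> x ^ (y * a) = x ^+ k.-1.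
Proof.
move=> /cycleP[i ->] /cycleP[j ->].
have cij : b ^+ i ^ (b ^+ j) = b ^+ i.
  by apply/conjg_fixP/commgP/commuteX2; apply: commute_refl.
by rewrite conjgM cij conjXg ba -!expgM mulnC.
Qed.

Lemma sd_order_a : #[a] = 2.
Proof.
apply: nt_prime_order => //; apply: contra notBa => /eqP ->; exact: group1.
Qed.

Lemma sd_sdprod : <[b]> ><| <[a]> = G.
Proof.
have nBA : <[a]> \subset 'N(<[b]>).
  rewrite cycle_subG; apply/normP; apply/eqP; rewrite eqEcard cardJg leqnn andbT.
  by rewrite -cycleJ ba cycle_subG mem_cycle.
have tiBA : <[b]> :&: <[a]> = 1.
  by rewrite setIC; apply: prime_TIg; rewrite ?cycle_subG // -orderE sd_order_a.
rewrite sdprodE // genG -norm_joinEr // joing_idl joing_idr.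
by rewrite setUC.
Qed.

Lemma sd_mem_b : b \in G.
Proof. by rewrite genG mem_gen // !inE eqxx orbT. Qed.

Lemma sd_mem_a : a \in G.
Proof. by rewrite genG mem_gen // !inE eqxx. Qed.


Lemma sd_out w : w \in G -> w \notin <[b]> -> exists i, w = b ^+ i * a.
Proof.
case/(mem_sdprod sd_sdprod) => _ [y [/cycleP[i ->]]].
rewrite (cycle2g sd_order_a) !inE => /orP[]/eqP-> -> _.
  by rewrite mulg1 mem_cycle.
by exists i.
Qed.

Lemma sd_out_sq i : (b ^+ i * a) ^+ 2 = b ^+ (i * k).
Proof.
have k0 : (0 < k)%N by apply: ltn_trans k_gt2.
have aba : a * b ^+ i * a = b ^+ (k.-1 * i).
  by rewrite -{1}sd_aV -mulgA -/(b ^+ i ^ a) conjXg ba -expgM.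
rewrite expgS expg1 -!mulgA (mulgA a) aba -expgD; congr (b ^+ _); lia.
Qed.

Lemma sd_out_involution i : ((b ^+ i * a) ^+ 2 == 1) = ~~ odd i.
Proof.
have k0 : (0 < k)%N by apply: ltn_trans k_gt2.
by rewrite sd_out_sq -order_dvdn ob dvdn_pmul2r // dvdn2.
Qed.

Lemma sd_notin i : b ^+ i * a \notin <[b]>.
Proof. by rewrite groupMl ?mem_cycle. Qed.

(** The square of an element outside [<[b]>] is some [b ^+ (i * k)], so its order divides 4, which
    is less than [2 * k]. *)
Lemma sd_generator x : x \in G -> #[x] = (2 * k)%N -> generator <[b]> x.
Proof.
move=> Gx ox; have Bx : x \in <[b]>.
  apply/idPn => /(sd_out Gx)[i xE].
  have : x ^+ 4 == 1.
    rewrite xE (expgM _ 2 2) sd_out_sq -expgM -order_dvdn ob.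
    by rewrite -mulnA (mulnC k) dvdn_mull.
  rewrite -order_dvdn ox => /dvdn_leq.
  lia.
by rewrite /generator eq_sym eqEcard cycle_subG Bx -!orderE ob ox leqnn.
Qed.

(** The maps sending [b] to [x] and [a] to [y] glue along the semidirect product, since
    [y = b ^+ j * a] also raises [<[b]>] to the power [k.-1]. *)
Lemma sd_extend x y :
    generator <[b]> x -> y \in G -> y \notin <[b]> -> y ^+ 2 = 1 ->
  exists2 u, u \in Aut G & u b = x /\ u a = y.
Proof.
move=> /eqP genx Gy notBy yy.
have ox : #[x] = #[b] by rewrite !orderE genx.
have Bx : x \in <[b]> by rewrite genx cycle_id.
have oy : #[y] = #[a].
  rewrite sd_order_a; apply: nt_prime_order => //.
  by apply: contra notBy => /eqP ->; exact: group1.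
have dx : #[x] %| #[b] by rewrite ox.
have dy : #[y] %| #[a] by rewrite oy.
have act : {in <[b]> & <[a]>, morph_act 'J 'J (eltm dx) (eltm dy)}.
  move=> _ y' /cycleP[i ->]; rewrite (cycle2g sd_order_a) !inE.
  case/orP => /eqP -> /=; first by rewrite morph1 !conjg1.
  rewrite eltm_id conjXg ba -expgM !eltmE.
  have [j ->] := sd_out Gy notBy.
  by rewrite sd_conj ?mem_cycle ?groupX // -expgM mulnC.
pose f := sdprodm sd_sdprod act.
(* [<[y]>] has order 2 and [y] lies outside [<[x]> = <[b]>], so the two images meet trivially. *)
have injf : 'injm f.
  have p2 : prime #|<[y]>| by rewrite -orderE oy sd_order_a.
  rewrite injm_sdprodm !injm_eltm ox oy !dvdnn !im_eltm /= setIC.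
  by rewrite prime_TIg //= -genx cycle_subG.
have fb : f b = x by rewrite /f sdprodmEl ?cycle_id //= eltm_id.
have fa : f a = y by rewrite /f sdprodmEr ?cycle_id //= eltm_id.
have Gx : x \in G by apply: subsetP Bx; rewrite cycle_subG sd_mem_b.
have fG : f @* G = G.
  apply/eqP; rewrite eqEcard card_injm // leqnn andbT.
  by rewrite im_sdprodm !im_eltm mul_subG ?cycle_subG.
exists (aut injf fG); first exact: Aut_aut.
by rewrite !autE ?sd_mem_a ?sd_mem_b.
Qed.

Lemma sd_Aut_ext u v :
  u \in Aut G -> v \in Aut G -> u b = v b -> u a = v a -> u = v.
Proof.
move=> Au Av ub ua; apply: (eq_Aut Au Av) => w.
case/(mem_sdprod sd_sdprod) => _ [_ [/cycleP[i ->] /cycleP[j ->] -> _]].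
have [Gb Ga] := (sd_mem_b, sd_mem_a).
change (autm_morphism Au (b ^+ i * a ^+ j)
        = autm_morphism Av (b ^+ i * a ^+ j)).
have ub' : autm_morphism Au b = autm_morphism Av b := ub.
have ua' : autm_morphism Au a = autm_morphism Av a := ua.
by rewrite !morphM ?groupX // !morphX // ub' ua'.
Qed.

Lemma card_semidihedral_Aut : #|Aut G| = (k * totient (2 * k))%N.
Proof.
have k0 : (0 < k)%N by apply: ltn_trans k_gt2.
have [Gb Ga] := (sd_mem_b, sd_mem_a).
pose phi (u : {perm gT}) := (u a, u b).
have injphi : {in Aut G &, injective phi}.
  by move=> u v Au Av [ua ub]; apply: sd_Aut_ext.
(* [Y] is the set of involutions outside [<[b]>]: these are the [b ^+ i * a] with [i] even. *)
pose Y := [set b ^+ (2 * i) * a | i : 'I_k].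
have cardY : #|Y| = k.
  rewrite card_imset ?card_ord // => i j /mulIg/eqP.
  rewrite eq_expg_mod_order ob !modn_small ?ltn_pmul2l // eqn_pmul2l // => /eqP.
  exact: val_inj.
rewrite -(card_in_imset injphi) -{1}cardY -ob totient_gen -cardsX.
apply: eq_card => -[y x]; rewrite in_setX inE; apply/imsetP/andP.
  case=> u Au [-> ->].
  change (u b) with (autm Au b); change (u a) with (autm Au a).
  have Bub : generator <[b]> (autm Au b).
    apply: sd_generator; last by rewrite order_injm ?injm_autm.
    by rewrite (autmE Au) Aut_closed.
  split=> //; have [| i uaE] := sd_out (Aut_closed Au Ga).
    (* An automorphism maps [<[b]>] onto itself, so the image of [a] stays outside it. *)
    have -> : <[b]> = autm Au @* <[b]> by rewrite morphim_cycle //; apply/eqP.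
    apply/negP => /morphimP[z Gz Bz uaz].
    have za := injmP (injm_autm Au) _ _ Ga Gz uaz.
    by move: notBa; rewrite za Bz.
  have evi : ~~ odd i.
    rewrite -sd_out_involution -uaE -[u a]/(autm_morphism Au a).
    by rewrite -morphX // aa morph1.
  have lti : ((i %% (2 * k))./2 < k)%N.
    by have := ltn_pmod i (_ : 0 < 2 * k)%N; lia.
  apply/imsetP; exists (Ordinal lti) => //=; apply: etrans uaE _; congr (_ * _).
  apply/eqP; rewrite eq_expg_mod_order ob; apply/eqP.
  have -> : (2 * (i %% (2 * k))./2)%N = (i %% (2 * k))%N.
    have : odd (i %% (2 * k)) = odd i by rewrite {2}(divn_eq i (2 * k)); lia.
    by lia.
  by rewrite modn_mod.
case=> /imsetP[i _ ->] genx.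
have [|||u Au [ub ua]] := sd_extend genx (_ : b ^+ (2 * i) * a \in G).
- by rewrite groupM ?groupX.
- exact: sd_notin.
- by apply/eqP; rewrite sd_out_involution oddM.
by exists u; rewrite // /phi ua ub.
Qed.
End SemidihedralAut.

(** * The explicit cycles of [a] and [b], with [k = 2h] and [q = 8h] *)

Lemma cycle_perm_nth (T : finType) (s : seq T) x0 n :
  uniq s -> n < size s -> cycle_perm s (nth x0 s n) = nth x0 s (n.+1 %% size s).
Proof.
move=> us lt_n; rewrite permE next_nth undup_id // mem_nth //.
rewrite index_uniq //; case: s us lt_n => // y s _ /=; rewrite ltnS leq_eqVlt.
(* At the last position the lookup in the tail is out of range and returns its default, the head of
   the cycle. *)
case/predU1P=> [-> | lt_n]; first by rewrite modnn nth_default.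
by rewrite modn_small //=; apply: set_nth_default.
Qed.

Lemma cycle_perm_out (T : finType) (s : seq T) x :
  x \notin s -> cycle_perm s x = x.
Proof. by move=> sx; rewrite permE next_nth mem_undup (negPf sx). Qed.

Lemma flatten_pairs (T : Type) (f g : nat -> T) n :
  flatten [seq [:: f i; g i] | i <- iota 0 n]
    = mkseq (fun j => if odd j then g j./2 else f j./2) (2 * n).
Proof.
elim: n => [|n IHn]; first by rewrite muln0.
rewrite -addn1 iotaD map_cat flatten_cat IHn mulnDr /mkseq iotaD map_cat.
by rewrite mul2n add0n /= odd_double doubleK uphalf_double.
Qed.

Section Generators.
Variables (F : finFieldType) (h : nat) (c : seq F).
Hypotheses (h_gt1 : 1 < h) (uc : uniq c) (size_c : size c = 8 * h).
Local Notation k := (2 * h).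
Local Open Scope ring_scope.

Let c_inj i j : (i < 8 * h)%N -> (j < 8 * h)%N -> c`_i = c`_j -> i = j.
Proof.
rewrite -size_c => lti ltj /eqP; rewrite nth_uniq // => /eqP; exact.
Qed.

Definition partner (j : nat) : nat := if odd j then j.-1 else j.+1.

Lemma perm_a_partner j : (j < 8 * h)%N -> perm_a k c c`_j = c`_(partner j).
Proof.
move=> ltj; rewrite /perm_a.
(* The first [m] transpositions swap exactly the indices below [2 * m] with their partners. *)
suff IH m : (m <= 2 * k)%N -> (\prod_(i < m) cycle_perm (a_cycle c i))%g c`_j
    = if (j < 2 * m)%N then c`_(partner j) else c`_j.
  by rewrite IH // (_ : j < 2 * (2 * k))%N //; lia.
elim: m => [_|m IHm ltm]; first by rewrite big_ord0 perm1.
rewrite big_ord_recr permM (IHm (ltnW ltm)) /=.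
have um : uniq (a_cycle c m).
  by rewrite /= inE andbT; apply/eqP => /c_inj; lia.
have := @cycle_perm_nth _ _ 0 _ um.
move=> cm; have := cm 0%N isT; have {cm} := cm 1%N isT; rewrite /= => cm1 cm0.
have [ltj2m | le2mj] := ltnP j (2 * m).
  rewrite (_ : j < 2 * m.+1)%N; last by lia.
  rewrite cycle_perm_out // !inE negb_or /partner.
  by apply/andP; split; apply/eqP => /c_inj; case: ifP; lia.
have [ltj2m2 | le2m2j] := ltnP j (2 * m.+1).
  have [-> | ->] : j = (2 * m)%N \/ j = (2 * m + 1)%N by lia.
    by rewrite cm0; congr c`_(_); rewrite /partner; case: ifP; lia.
  by rewrite cm1; congr c`_(_); rewrite /partner; case: ifP; lia.
rewrite cycle_perm_out // !inE negb_or.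
by apply/andP; split; apply/eqP => /c_inj; lia.
Qed.

(* The entry in position [j] of the first (below: second) cycle of [b] is
   [c_(b_index1 j)] (resp. [c_(b_index2 j)]). *)
Definition b_index1 (j : nat) : nat :=
  if odd j then (4 * h + j.-1 + (j < k))%N else (j + (j == k))%N.

Definition b_index2 (j : nat) : nat :=
  if odd j then if j.+1 == k then k else (4 * h - j)%N
  else if (j < k - 2)%N then (6 * h - 2 - j)%N
  else if (j == k - 2)%N then (4 * h)%N else (10 * h - 1 - j)%N.

Lemma b_cycle1E : b_cycle1 k c = mkseq (fun j => c`_(b_index1 j)) (2 * k).
Proof.
rewrite /b_cycle1 /n1_range /n2_range !flatten_pairs.
have e1 : (2 * ((2 * h - 2) %/ 2).+1 = 2 * h)%N by lia.
have e2 : (2 * ((2 * h - 4) %/ 2).+1 = 2 * h - 2)%N by lia.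
rewrite e1 e2; apply: (@eq_from_nth _ 0) => [|i].
  by rewrite !size_cat !size_mkseq /=; lia.
rewrite !size_cat !size_mkseq /= => lti.
rewrite nth_mkseq; last by lia.
rewrite nth_cat size_mkseq; case: ifP => lti1.
  by rewrite nth_mkseq // /b_index1; case: ifP => oi; congr c`_(_); lia.
have [ei | [ei | gei]] : (i = 2 * h \/ i = 2 * h + 1 \/ 2 * h + 2 <= i)%N by lia.
- by rewrite ei subnn /= /b_index1; case: ifP => oi; congr c`_(_); lia.
- by rewrite ei addKn /= /b_index1; case: ifP => oi; congr c`_(_); lia.
rewrite (_ : (i - 2 * h = (i - 2 * h - 2).+2)%N) /=; last by lia.
rewrite nth_mkseq; last by lia.
by rewrite /b_index1; case: ifP => oi; case: ifP => oi'; congr c`_(_); lia.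
Qed.

Lemma b_cycle2E : b_cycle2 k c = mkseq (fun j => c`_(b_index2 j)) (2 * k).
Proof.
rewrite /b_cycle2 /n1_range /n2_range !flatten_pairs.
have e1 : (2 * ((2 * h - 2) %/ 2).+1 = 2 * h)%N by lia.
have e2 : (2 * ((2 * h - 4) %/ 2).+1 = 2 * h - 2)%N by lia.
rewrite e1 e2; apply: (@eq_from_nth _ 0) => [|i].
  by rewrite !size_cat !size_mkseq /=; lia.
rewrite !size_cat !size_mkseq /= => lti.
rewrite nth_mkseq; last by lia.
rewrite nth_cat size_mkseq; case: ifP => lti1.
  rewrite nth_mkseq // /b_index2; case: ifP => oi; congr c`_(_);
    last by case: ifP; lia.
  by case: ifP; lia.
(* Positions [k - 2] and [k - 1] hold the middle pair of indices [2 * k] and [k], between the two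
   interleaved blocks. *)
have [ei | [ei | gei]] :
  (i = 2 * h - 2 \/ i = 2 * h - 1 \/ 2 * h <= i)%N by lia.
- rewrite ei subnn /= /b_index2; case: ifP => oi; congr c`_(_); first by lia.
  by case: ifP => ?; [lia | case: ifP; lia].
- rewrite ei (_ : (2 * h - 1 - (2 * h - 2) = 1)%N); last by lia.
  rewrite /= /b_index2; case: ifP => oi; congr c`_(_); last by lia.
  by case: ifP; lia.
rewrite (_ : (i - (2 * h - 2) = (i - 2 * h).+2)%N) /=; last by lia.
rewrite nth_mkseq; last by lia.
rewrite /b_index2; case: ifP => oi; case: ifP => oi'; congr c`_(_); try lia.
  by case: ifP; lia.
by case: ifP => ?; [lia | case: ifP; lia].
Qed.

Lemma b_index1_lt j : (j < 2 * k)%N -> (b_index1 j < 8 * h)%N.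
Proof. by rewrite /b_index1; case: ifP => ?; lia. Qed.

Lemma b_index2_lt j : (j < 2 * k)%N -> (b_index2 j < 8 * h)%N.
Proof.
by rewrite /b_index2; case: ifP => ?; case: ifP => ?; try (case: ifP => ?); lia.
Qed.

Lemma b_index1_inj i j : (i < 2 * k)%N -> (j < 2 * k)%N ->
  b_index1 i = b_index1 j -> i = j.
Proof. by rewrite /b_index1; case: ifP => ?; case: ifP => ?; lia. Qed.

Lemma b_index2_inj i j : (i < 2 * k)%N -> (j < 2 * k)%N ->
  b_index2 i = b_index2 j -> i = j.
Proof. by rewrite /b_index2; do !case: ifP => ?; lia. Qed.

Lemma b_index_disjoint i j : (i < 2 * k)%N -> (j < 2 * k)%N ->
  b_index1 i <> b_index2 j.
Proof. by rewrite /b_index1 /b_index2; do !case: ifP => ?; lia. Qed.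

Lemma uniq_b_cycle1 : uniq (b_cycle1 k c).
Proof.
rewrite b_cycle1E; apply/mkseq_uniqP => i j; rewrite !inE => lti ltj.
by move/c_inj => /(_ (b_index1_lt lti) (b_index1_lt ltj)); apply: b_index1_inj.
Qed.

Lemma uniq_b_cycle2 : uniq (b_cycle2 k c).
Proof.
rewrite b_cycle2E; apply/mkseq_uniqP => i j; rewrite !inE => lti ltj.
by move/c_inj => /(_ (b_index2_lt lti) (b_index2_lt ltj)); apply: b_index2_inj.
Qed.

Lemma b_cycle_disjoint i j : (i < 2 * k)%N -> (j < 2 * k)%N ->
  c`_(b_index1 i) <> c`_(b_index2 j).
Proof.
move=> lti ltj /c_inj => /(_ (b_index1_lt lti) (b_index2_lt ltj)).
exact: b_index_disjoint.
Qed.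

(** The two cycles are disjoint, so the second one fixes every entry of the first. *)
Lemma perm_b_index1 j : (j < 2 * k)%N ->
  perm_b k c c`_(b_index1 j) = c`_(b_index1 (j.+1 %% (2 * k))).
Proof.
move=> ltj; have k0 : (0 < 2 * k)%N by lia.
have := @cycle_perm_nth _ _ 0 j uniq_b_cycle1.
rewrite b_cycle1E size_mkseq !nth_mkseq ?ltn_mod // -b_cycle1E => /(_ ltj) c1.
rewrite permM c1 cycle_perm_out // b_cycle2E; apply/mapP => -[i].
by rewrite mem_iota => lti; apply: b_cycle_disjoint => //; rewrite ltn_mod.
Qed.

Lemma perm_b_index2 j : (j < 2 * k)%N ->
  perm_b k c c`_(b_index2 j) = c`_(b_index2 (j.+1 %% (2 * k))).
Proof.
move=> ltj; have k0 : (0 < 2 * k)%N by lia.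
have := @cycle_perm_nth _ _ 0 j uniq_b_cycle2.
rewrite b_cycle2E size_mkseq !nth_mkseq ?ltn_mod // -b_cycle2E => /(_ ltj) c2.
rewrite permM (cycle_perm_out (s := b_cycle1 k c)) // b_cycle1E.
by apply/mapP => -[i]; rewrite mem_iota => lti /esym; apply: b_cycle_disjoint.
Qed.

Lemma b_index10 : b_index1 0 = 0%N.
Proof. by rewrite /b_index1 /=; lia. Qed.

Lemma perm_bX n : (perm_b k c ^+ n)%g c`_0 = c`_(b_index1 (n %% (2 * k))).
Proof.
elim: n => [|n IHn]; first by rewrite perm1 mod0n b_index10.
have k0 : (0 < 2 * k)%N by lia.
rewrite expgSr permM IHn perm_b_index1 ?ltn_mod //.
by rewrite -(addn1 (n %% _)) modnDml addn1.
Qed.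

(* By regularity it suffices to compare both sides of a relation at [c_0]. *)
Lemma group_ab_regular_relations :
    regular_perm (group_ab k c) ->
  [/\ #[perm_b k c]%g = (2 * k)%N, (perm_a k c ^+ 2 = 1)%g,
      perm_a k c \notin <[perm_b k c]>%g &
      (perm_b k c ^ perm_a k c = perm_b k c ^+ k.-1)%g].
Proof.
move=> [ffG _]; set a := perm_a k c; set b := perm_b k c.
have Ga : a \in group_ab k c by rewrite mem_gen // !inE eqxx.
have Gb : b \in group_ab k c by rewrite mem_gen // !inE eqxx orbT.
have k0 : (0 < 2 * k)%N by lia.
have bXn n : (b ^+ n)%g c`_0 = c`_(b_index1 (n %% (2 * k))) := perm_bX n.
have a0 : a c`_0 = c`_1 by rewrite /a perm_a_partner //; lia.
have a1 : a c`_1 = c`_0 by rewrite /a perm_a_partner //; lia.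
(* [c_1] closes the second cycle, so [b] sends it to that cycle's first entry, of index
   [3k - 2 = 6h - 2]. *)
have c1E : c`_1 = c`_(b_index2 (2 * k).-1).
  by rewrite /b_index2; do !case: ifP => ?; congr c`_(_); lia.
have b1 : b c`_1 = c`_(6 * h - 2).
  rewrite c1E /b perm_b_index2 ?prednK ?modnn //.
  by rewrite /b_index2; do !case: ifP => ?; congr c`_(_); lia.
split.
- apply/eqP; rewrite eqn_dvd order_dvdn; apply/andP; split.
    apply/eqP; apply: (fixpoint_free_inj ffG (x := c`_0)); rewrite ?groupX //.
    by rewrite bXn modnn b_index10 perm1.
  have := bXn #[b]%g; rewrite expg_order perm1 => /c_inj.
  have lt_m : (#[b]%g %% (2 * k) < 2 * k)%N by rewrite ltn_mod.
  move=> e; have e0 : 0%N = b_index1 (#[b]%g %% (2 * k)).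
    by apply: e; [lia | apply: b_index1_lt].
  by rewrite /dvdn -(b_index1_inj k0 lt_m) ?b_index10.
- apply: (fixpoint_free_inj ffG (x := c`_0)); rewrite ?groupX //.
  by rewrite permM a0 a1 perm1.
(* Powers of [b] keep [c_0] in the first cycle, whereas [a] moves it to [c_1] in the second. *)
- apply/cycleP => -[n ab]; have := bXn n; rewrite -ab a0.
  have lt_m : (n %% (2 * k) < 2 * k)%N by rewrite ltn_mod.
  have lt_m' : ((2 * k).-1 < 2 * k)%N by lia.
  by rewrite c1E => /esym; apply: b_cycle_disjoint.
apply: (fixpoint_free_inj ffG (x := c`_0)); rewrite ?groupX ?groupJ //.
(* The conjugate takes [c_0] through [c_1] and [c_(6h-2)] to [c_(6h-1)], the entry at position
   [k - 1] of the first cycle. *)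
have aV0 : a^-1%g c`_0 = c`_1 by rewrite -a1 permK.
have -> : (b ^ a)%g c`_0 = a (b (a^-1%g c`_0)) by rewrite !permM.
rewrite aV0 b1 bXn modn_small; last by lia.
rewrite /a perm_a_partner; last by lia.
rewrite /partner /b_index1; do !case: ifP => ?; congr c`_(_); lia.
Qed.

End Generators.

From mathcomp Require Import boolp classical_sets cardinality.
Local Open Scope ring_scope.

(** * Reduced polynomials as functions of two variables *)

Section ReducedPolynomials.
Variable F : finFieldType.
Local Open Scope ring_scope.
Local Notation n := #|F|.
Implicit Types (f g : {mpoly F[2]}).

(** A nonzero polynomial of degree below [#|F|] cannot have all of [F] as roots. *)
Lemma sum_exp_eq0 (u : 'I_n -> F) :
  (forall x : F, \sum_i u i * x ^+ i = 0) -> forall i, u i = 0.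
Proof.
move=> u0; pose p : {poly F} := \sum_(i < n) u i *: 'X^i.
have p0 : p = 0.
  apply/eqP/idPn => nzp; have := max_poly_roots nzp (rs := enum F).
  suff roots_p : all (root p) (enum F).
    rewrite enum_uniq -cardE => /(_ roots_p isT); apply/negP; rewrite -leqNgt.
    apply: leq_trans (size_sum _ _ _) _; apply/bigmax_leqP => i _.
    by apply: leq_trans (size_scale_leq _ _) _; rewrite size_polyXn.
  apply/allP => x _; rewrite /root /p horner_sum -[X in _ == X](u0 x).
  by apply/eqP/eq_bigr => i _; rewrite hornerZ hornerXn.
move=> i; have := congr1 (fun r : {poly F} => r`_i) p0.
rewrite /p coef0 coef_sum (bigD1 i) //= coefZ coefXn eqxx mulr1.
rewrite big1 ?addr0 // => j ji.
by rewrite coefZ coefXn eq_sym (inj_eq val_inj) (negPf ji) mulr0.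
Qed.

Definition grid_mnm (i : 'I_n * 'I_n) : 'X_{1..2} :=
  [multinom tnth [tuple (i.1 : nat); (i.2 : nat)] t | t < 2].

Lemma grid_mnm_inj : injective grid_mnm.
Proof.
move=> [i j] [i' j'] /mnmP e; have := e ord0; have := e (lift ord0 ord0).
by rewrite !mnmE /= => /val_inj -> /val_inj ->.
Qed.

Lemma grid_mnmP (m : 'X_{1..2}) :
  (forall i, m i < n)%N -> exists i, m = grid_mnm i.
Proof.
move=> mn; exists (Ordinal (mn ord0), Ordinal (mn (lift ord0 ord0))).
apply/mnmP => t; rewrite mnmE; case: t => [[|[|//]] it] /=; 
  rewrite /tnth /=; congr (m _); exact: val_inj.
Qed.

Definition grid_poly (A : {ffun 'I_n * 'I_n -> F}) : {mpoly F[2]} :=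
  \sum_i A i *: 'X_[grid_mnm i].

Lemma mcoeff_grid A i : (grid_poly A)@_(grid_mnm i) = A i.
Proof.
rewrite raddf_sum (bigD1 i) //= mcoeffZ mcoeffX eqxx mulr1.
rewrite big1 ?addr0 // => j ji.
by rewrite mcoeffZ mcoeffX (inj_eq grid_mnm_inj) (negPf ji) mulr0.
Qed.

Lemma mcoeff_grid0 A m : (forall i, m <> grid_mnm i) -> (grid_poly A)@_m = 0.
Proof.
move=> nm; rewrite raddf_sum big1 //= => i _.
by rewrite mcoeffZ mcoeffX; case: eqP => [/esym/nm | _]; rewrite ?mulr0.
Qed.

Lemma reduced_grid A : reduced (grid_poly A).
Proof.
move=> m; rewrite mcoeff_msupp => nz i.
have [[j ->] | nm] := pselect (exists j, m = grid_mnm j).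
  by rewrite mnmE; case: i => [[|[|//]] it]; rewrite /tnth /= ltn_ord.
by case/eqP: nz; apply: mcoeff_grid0 => j mj; case: nm; exists j.
Qed.

Lemma reduced_gridP f : reduced f -> exists A, f = grid_poly A.
Proof.
move=> redf; exists [ffun i => f@_(grid_mnm i)]; apply/mpolyP => m.
have [[j ->] | nm] := pselect (exists j, m = grid_mnm j).
  by rewrite mcoeff_grid ffunE.
rewrite mcoeff_grid0; last by move=> j mj; apply: nm; exists j.
apply/eqP; rewrite mcoeff_eq0; apply/negP => /redf/grid_mnmP[i mi].
by apply: nm; exists i.
Qed.

Lemma eval2_grid A x y :
  eval2 (grid_poly A) x y = \sum_i \sum_j A (i, j) * (x ^+ i * y ^+ j).
Proof.
rewrite pair_big /= /eval2 raddf_sum /=; apply: eq_bigr => -[i j] _.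
by rewrite mevalZ mevalX big_ord_recl big_ord1 !mnmE.
Qed.

(** The one-variable case is used twice: for fixed [y] the coefficients of the powers of [x] vanish,
    and each of these is a polynomial in [y]. *)
Lemma eval2_grid_inj A B : eval2 (grid_poly A) =2 eval2 (grid_poly B) -> A = B.
Proof.
move=> eAB; apply/ffunP => -[i j]; apply/eqP; rewrite -subr_eq0; apply/eqP.
move: j; apply: (@sum_exp_eq0 (fun j => A (i, j) - B (i, j))) => y.
move: i; pose u i := \sum_j (A (i, j) - B (i, j)) * y ^+ j.
apply: (@sum_exp_eq0 u) => x.
have := eAB x y; rewrite !eval2_grid => /eqP; rewrite -subr_eq0 => /eqP eAB0.
apply: etrans eAB0; rewrite -[RHS]sumrB; apply: eq_bigr => i _.
rewrite -[RHS]sumrB mulr_suml.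
by apply: eq_bigr => j _; rewrite -mulrBl -mulrA (mulrC (y ^+ j)).
Qed.

Lemma reduced_eval2_inj f g :
  reduced f -> reduced g -> eval2 f =2 eval2 g -> f = g.
Proof.
by move=> /reduced_gridP[A ->] /reduced_gridP[B ->] /eval2_grid_inj->.
Qed.

(* Evaluation is injective between two finite sets of the same cardinality. *)
Lemma reduced_interpolation (phi : F -> F -> F) :
  exists2 f, reduced f & eval2 f =2 phi.
Proof.
pose ev (A : {ffun 'I_n * 'I_n -> F}) :=
  [ffun z : F * F => eval2 (grid_poly A) z.1 z.2].
have inj_ev : injective ev.
  move=> A B /ffunP eAB; apply: eval2_grid_inj => x y.
  by have := eAB (x, y); rewrite !ffunE.
have [|ev' _ evK] := inj_card_bij inj_ev.
  by rewrite !card_ffun !card_prod !card_ord.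
exists (grid_poly (ev' [ffun z => phi z.1 z.2])); first exact: reduced_grid.
move=> x y; have /ffunP/(_ (x, y)) := evK [ffun z => phi z.1 z.2].
by rewrite !ffunE.
Qed.

End ReducedPolynomials.

(** * Counting polynomials through their permutation tuples *)

Lemma card_tuples_of_sets (T : finType) (m : nat) (C : {set {set T}}) :
    {in C, forall A : {set T}, #|A| = m} ->
  #|[set t : m.-tuple T | uniq t & [set s in t] \in C]| = (#|C| * m`!)%N.
Proof.
move=> cardC.
(* Tuples are grouped by their underlying set, each set of [m] elements having [m]! orderings. *)
pose toset (t : m.-tuple T) := [set s in t].
rewrite -sum1_card (partition_big toset (mem C)) /=; last first.
  by move=> t; rewrite inE => /andP[].
rewrite -sum_nat_const; apply: eq_bigr => A CA.
rewrite sum1dep_card.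
transitivity (#|A| ^_ m)%N; last by rewrite cardC ?ffactnn.
rewrite -card_uniq_tuples.
apply: eq_card => t; rewrite !inE /toset; apply/andP/andP.
  case=> /andP[ut _] /eqP <-; split=> //; apply/allP => s ts.
  by change (s \in [set s0 in t]); rewrite inE.
case=> /allP tA ut; suff -> : [set s in t] = A by rewrite ut CA eqxx.
apply/eqP; rewrite eqEcard; apply/andP; split.
  by apply/fintype.subsetP => s; rewrite inE => /tA.
by rewrite cardsE (card_uniqP ut) size_tuple cardC.
Qed.

Section Counting.
Variables (F : finFieldType) (q : nat) (c : q.-tuple F).
Hypotheses (cardF : #|F| = q) (uc : uniq c).
Implicit Types (f g : {mpoly F[2]}) (beta : q.-tuple {perm F}).
Local Open Scope ring_scope.

Lemma perm_poly_tuple_inj beta x :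
  perm_poly_tuple beta -> injective (fun i => tnth beta i x).
Proof.
move=> pb i j bij; apply/eqP/idPn => /pb/(_ (tnth beta j x))/eqP; apply.
by rewrite permM permK.
Qed.

Lemma perm_poly_tuple_surj beta x y :
  perm_poly_tuple beta -> exists i, tnth beta i x = y.
Proof.
move=> pb; have [|h _ hK] := inj_card_bij (perm_poly_tuple_inj (x := x) pb).
  by rewrite card_ord cardF.
by exists (h y).
Qed.

(** Each point [(x, y)] lies on the graph of exactly one entry of [beta], and the value of [f] there
    identifies that entry because [c] has no repetition. *)
Lemma tuple_of_lpp_lpp f beta : tuple_of_lpp c f beta -> lpp f.
Proof.
move=> [pb fb] z; split; apply: injF_bij => x y.
  have [i bi] := perm_poly_tuple_surj x z pb; rewrite -{1}bi fb.
  have [j bj] := perm_poly_tuple_surj y z pb; rewrite -{1}bj fb.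
  move=> /(tuple_uniqP _ uc) ij; apply: (@perm_inj _ (tnth beta i)).
  by rewrite bi ij bj.
have [i <-] := perm_poly_tuple_surj z x pb; rewrite fb.
have [j <-] := perm_poly_tuple_surj z y pb; rewrite fb.
by move=> /(tuple_uniqP _ uc) ->.
Qed.

(** The value of the [i]-th entry at [x] is the only [y] at which [f] takes the value [c_i] on the
    line through [x]. *)
Lemma tuple_of_lpp_inj f beta beta' :
  tuple_of_lpp c f beta -> tuple_of_lpp c f beta' -> beta = beta'.
Proof.
move=> fb fb'; have [_ /bij_inj inj] := tuple_of_lpp_lpp fb 0.
apply: eq_from_tnth => i; apply/permP => x.
have [_ /bij_inj injx] := tuple_of_lpp_lpp fb x.
by apply: injx; rewrite fb.2 fb'.2.
Qed.

Lemma tuple_of_lpp_eval2 f g beta :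
  tuple_of_lpp c f beta -> tuple_of_lpp c g beta -> eval2 f =2 eval2 g.
Proof.
move=> [pb fb] [_ gb] x y; have [i <-] := perm_poly_tuple_surj x y pb.
by rewrite fb gb.
Qed.

Lemma corresponds_to_inj f (H K : {group {perm F}}) :
  corresponds_to c f H -> corresponds_to c f K -> H :=: K.
Proof.
by case=> _ _ [b fb <-] [_ _ [b' fb' <-]]; rewrite (tuple_of_lpp_inj fb fb').
Qed.

Lemma lpp_of_tuple beta :
  perm_poly_tuple beta -> exists2 f, reduced f & tuple_of_lpp c f beta.
Proof.
move=> pb.
pose phi x y := odflt 0 (omap (tnth c) [pick i | tnth beta i x == y]).
have [f redf fphi] := reduced_interpolation phi.
exists f => //; split=> // i x; rewrite fphi /phi.
case: pickP => [j /eqP/(perm_poly_tuple_inj pb) -> // | /(_ i)].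
by rewrite eqxx.
Qed.

Lemma perm_poly_tuple_group beta (H : {group {perm F}}) :
    [set s in beta] = H ->
  perm_poly_tuple beta <-> uniq beta /\ regular_perm H.
Proof.
move=> bH; have memH s : (s \in H) = (s \in beta) by rewrite -bH inE.
have memHt i : tnth beta i \in H by rewrite memH mem_tnth.
split=> [pb | [ub [ffH _]] i j ij x].
  have ub : uniq beta.
    apply/tuple_uniqP => i j bij.
    by apply: (perm_poly_tuple_inj (x := 0) pb); rewrite bij.
  split=> //; split.
    move=> s; rewrite memH => /tnthP[i ->] nt x.
    (* Comparing an entry with the identity entry shows that it has no fixed point. *)
    have /tnthP[j bj] : 1%g \in beta by rewrite -memH group1.
    have ij : i != j by apply: contra nt => /eqP ->; rewrite -bj.
    by have := pb i j ij x; rewrite -bj invg1 mul1g.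
  by rewrite -bH cardsE (card_uniqP ub) size_tuple cardF.
apply: ffH; first by rewrite groupM ?groupV.
by rewrite -eq_mulVg1 (inj_eq (tuple_uniqP _ ub)) eq_sym.
Qed.

(** Polynomials correspond bijectively to their tuples, and the tuples in question are the orderings
    of the conjugates of [G], all of which are regular and isomorphic to [G]. *)
Lemma num_same_form_regular f (G : {group {perm F}}) :
    corresponds_to c f G ->
  regular_perm G /\ num_same_form c f = (#|(G :^: [set: {perm F}])%g| * q`!)%N.
Proof.
move=> fG; have [_ _ [b0 fb0 b0G]] := fG.
have [_ regG] := (perm_poly_tuple_group b0G).1 fb0.1; split=> //.
have F0 : (0 < #|F|)%N by apply/card_gt0P; exists 0.
pose C := (G :^: [set: {perm F}])%g.
have conjP H : H \in C ->
    exists2 K : {group {perm F}}, H = K & G \isog K /\ regular_perm K.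
  case/imsetP => s _ ->; exists (G :^ s)%G => //; split; first exact: conj_isog.
  split; last by rewrite cardJg regG.2.
  move=> t; rewrite mem_conjg => Gt nt x.
  have := regG.1 _ Gt _ (s^-1%g x); rewrite conjg_eq1 => /(_ nt).
  by rewrite permJ (inj_eq perm_inj).
pose B := [set t : q.-tuple {perm F} | uniq t & [set s in t] \in C].
rewrite -(@card_tuples_of_sets _ q); last first.
  by move=> H /conjP[K -> [_ [_ ->]]].
have BP beta : beta \in B -> perm_poly_tuple beta /\
    exists2 K : {group {perm F}}, [set s in beta] = K & G \isog K.
  rewrite inE => /andP[ub /conjP[K bK [isoK regK]]]; split; last by exists K.
  exact/(perm_poly_tuple_group bK).
(* With the membership condition under the existential, choice yields a function [pol] on all
   tuples; outside [B] its value is irrelevant. *)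
have polyP beta : exists f, beta \in B -> reduced f /\ tuple_of_lpp c f beta.
  case: (boolP (beta \in B)) => [/BP[/lpp_of_tuple[g]] | _]; last by exists 0.
  by exists g.
have [pol {}polyP] := choice polyP.
rewrite /num_same_form.
(* Presenting the set as the image of [B] under [pol] shows that it is finite, so [fset_set] returns
   its true elements. *)
have -> : [set g | perm_group_poly c g /\ same_form c f g]%classic
    = [set` [fset pol t | t in enum B]%fset]%classic.
  apply/seteqP; split=> g /=.
    move=> [_ [H [K [fH gK isoHK]]]].
    have GH := corresponds_to_inj fG fH.
    have [redg lppg [beta gb bK]] := gK.
    have [ub regK] := (perm_poly_tuple_group bK).1 gb.1.
    have Bb : beta \in B.
      rewrite inE ub bK; apply: regular_isog_conj => //; first exact: regK.1.
      by rewrite GH.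
    apply/imfsetP; exists beta => /=; first by rewrite mem_enum.
    have [redp pb] := polyP _ Bb.
    apply: reduced_eval2_inj => //; exact: tuple_of_lpp_eval2 gb pb.
  move=> /imfsetP[beta /=]; rewrite mem_enum => Bb ->.
  have [redp pb] := polyP _ Bb.
  have [ppb [K bK isoK]] := BP _ Bb.
  have pK : corresponds_to c (pol beta) K.
    by split=> //; [apply: tuple_of_lpp_lpp pb | exists beta].
  by split; [exists K | exists G, K].
rewrite set_fsetK card_in_imfset /=.
  by rewrite undup_id ?enum_uniq // -cardE.
move=> b b'; rewrite /= !mem_enum => Bb Bb' ebb'.
have [_ pb] := polyP _ Bb; have [_ pb'] := polyP _ Bb'.
by apply: tuple_of_lpp_inj pb _; rewrite ebb'.
Qed.

End Counting.

Theorem theorem4p16 (l k q : nat) (hl : (2 <= l)%N) (hk : k = (2 ^ l)%N)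
    (hq : q = (4 * k)%N)
    (F : finFieldType) (hF : #|F| = q)
    (c : q.-tuple F) (hc : uniq c)
    (f3 : {mpoly F[2]}) (hf3 : corresponds_to c f3 (group_ab k c)) :
  (num_same_form c f3)%:R
    = 4%:R * (q`!)%:R ^+ 2 / (q%:R ^+ 2 * (totient (q %/ 2))%:R) :> rat.
Proof.
have [h kE h_gt1] : exists2 h, k = (2 * h)%N & (1 < h)%N.
  case: l hl hk => [|l] // hl ->; exists (2 ^ l)%N; first by rewrite expnS.
  by rewrite -{1}(expn0 2) ltn_exp2l.
have [regG ->] := num_same_form_regular hF hc hf3.
have sz_c : size c = (8 * h)%N by rewrite size_tuple; lia.
have [] := group_ab_regular_relations h_gt1 hc sz_c; first by rewrite -kE.
rewrite -kE => ob aa notBa ba.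
have k_gt2 : (2 < k)%N by lia.
have q_gt0 : (0 < q)%N by lia.
have cardC := card_regular_conjugates regG; rewrite hF in cardC.
have := cardC q_gt0.
rewrite (card_semidihedral_Aut k_gt2 ob aa notBa ba erefl).
have -> : (q %/ 2 = 2 * k)%N by lia.
set C := #|_|; set t := totient _ => cardE.
have t_gt0 : (0 < t)%N by rewrite totient_gt0; lia.
(* The count is [C * q]![; substituting this value for]q[!] and [4k] for [q] turns the claim into a
   field identity in [C], [k] and [t]. *)
have qfact : (q`!)%:R = C%:R * (k%:R * t%:R * (4%:R * k%:R)) :> rat.
  by rewrite -cardE !natrM hq natrM.
rewrite natrM qfact hq natrM.
have k0 : k%:R != 0 :> rat by rewrite Num.Theory.pnatr_eq0; lia.
have t0 : t%:R != 0 :> rat by rewrite Num.Theory.pnatr_eq0; lia.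
by field; rewrite k0 t0.
Qed.
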